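(* The following two statements are equivalent: (1) for every stream $s$, if $\neg\,\nu\mathcal{U}\,s$, then the set $\mathcal{R}_s$ of red positions of $s$ is streamless; (2) for every stream $s$, if $\neg\,\mathcal{G}\,\mathit{blue}\,s$, then $\mathcal{F}\,\mathit{red}\,s$ (this is Markov's Principle).
   Context: The equivalence is to be proved constructively (intuitionistic type theory with inductive and coinductive definitions; no excluded middle, no Markov's principle). A color is one of $R$ (red), $B$ (blue). A stream is an element of the coinductive type whose only constructor forms $c\,s$ from a color $c$ and a stream $s$; streams are considered up to bisimilarity (equivalently, functions $\mathbb{N}\to\{R,B\}$ up to pointwise equality). $s@n$ denotes the color of $s$ at position $n$ (positions start at $0$). $\mathit{red}\,s$ means $s=R\,s'$ for some $s'$; $\mathit{blue}\,s$ means $s=B\,s'$ for some $s'$. For a stream predicate $X$: $\mathcal{F}\,X$ is defined inductively by the rules: $X\,s$ implies $\mathcal{F}\,X\,s$; $\mathcal{F}\,X\,s$ implies $\mathcal{F}\,X\,(c\,s)$ for any color $c$. $\mathcal{G}\,X$ is defined coinductively by the rule: $X\,(c\,s)$ and $\mathcal{G}\,X\,s$ imply $\mathcal{G}\,X\,(c\,s)$. For a stream predicate $X$, the strong until predicate $\mathcal{U}_X$ is defined inductively by the rules: $\mathcal{U}_X\,s$ implies $\mathcal{U}_X\,(B\,s)$; $X\,s$ implies $\mathcal{U}_X\,(R\,s)$. $\nu\mathcal{U}$ (''infinitely often red'') is the greatest fixed point of the monotone operator $X\mapsto\mathcal{U}_X$, i.e. the predicate defined coinductively by the rule: $\mathcal{U}_{\nu\mathcal{U}}\,s$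 implies $\nu\mathcal{U}\,s$. $\mathcal{R}_s=\{n\in\mathbb{N}\mid s@n=R\}$. For a set $A$, the duplicate-free colists $\mathit{colist}\,A$ over $A$ are defined coinductively: $\langle\rangle:\mathit{colist}\,A$; and if $x\in A$ and $\ell:\mathit{colist}\,(A\setminus\{x\})$ then $x\,\ell:\mathit{colist}\,A$. Finiteness $\ell\downarrow$ is defined inductively: $\langle\rangle\downarrow$; and $\ell\downarrow$ implies $(x\,\ell)\downarrow$. $A$ is streamless if $\ell\downarrow$ for every $\ell:\mathit{colist}\,A$. *)

(* Defs.v *)
From Stdlib Require Export Streams.

Set Implicit Arguments.

(* Everything is in the pure calculus, without axioms: under excluded middle
   Markov's Principle holds outright, so the content of the equivalence lies
   in its being derivable with no classical principle. *)

Inductive color : Set := R | B.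

Definition stream : Type := Stream color.

Definition red (s : stream) : Prop := exists s' : stream, s = Cons R s'.
Definition blue (s : stream) : Prop := exists s' : stream, s = Cons B s'.

(* [Exists] and [ForAll] are stated with [tl]; as every stream is of the form
   [Cons c s], their rules are the constructor-form rules of F and G. *)
Definition F (X : stream -> Prop) (s : stream) : Prop := Exists X s.
Definition G (X : stream -> Prop) (s : stream) : Prop := ForAll X s.

Inductive U (X : stream -> Prop) : stream -> Prop :=
| U_blue (s : stream) : U X s -> U X (Cons B s)
| U_red (s : stream) : X s -> U X (Cons R s).

Lemma U_mono (X Y : stream -> Prop) :
  (forall s, X s -> Y s) -> forall s, U X s -> U Y s.
Proof. intros H s u; induction u; constructor; auto. Qed.

(* The greatest fixed point of X |-> U X, as the union of all post-fixed
   points. A [CoInductive] with the rule U nuU s -> nuU s is accepted, but the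
   inductive U nested in it makes [cofix] fail to prove the coinduction
   principle; here the rule, its inversion and coinduction are
   the three lemmas below. *)
Definition nuU (s : stream) : Prop :=
  exists X : stream -> Prop, (forall t, X t -> U X t) /\ X s.

Lemma nuU_coind (X : stream -> Prop) :
  (forall t, X t -> U X t) -> forall s, X s -> nuU s.
Proof. intros H s x; exists X; split; assumption. Qed.

Lemma nuU_unfold (s : stream) : nuU s -> U nuU s.
Proof.
  intros [X [H x]]; apply (U_mono (X := X)).
  - apply nuU_coind; assumption.
  - apply H; assumption.
Qed.

Lemma nuU_intro (s : stream) : U nuU s -> nuU s.
Proof. apply nuU_coind; intros t u; revert u; apply U_mono, nuU_unfold. Qed.

Definition red_positions (s : stream) : nat -> Prop := fun n => Str_nth n s = R.

Definition remove (T : Type) (A : T -> Prop) (x : T) : T -> Prop :=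
  fun y => A y /\ y <> x.

(* Sets are predicates; the tail of a colist over A is a colist over A \ {x},
   hence A is a non-uniform parameter. *)
CoInductive colist (T : Type) (A : T -> Prop) : Type :=
| conil : colist A
| cocons (x : T) : A x -> colist (remove A x) -> colist A.

Arguments conil {T A}.
Arguments cocons {T A} x _ _.

Inductive colist_finite (T : Type) (A : T -> Prop) : colist A -> Prop :=
| finite_nil : colist_finite (conil (A := A))
| finite_cons (x : T) (Ax : A x) (l : colist (remove A x)) :
    colist_finite l -> colist_finite (cocons x Ax l).

Definition streamless (T : Type) (A : T -> Prop) : Prop :=
  forall l : colist A, colist_finite l.

(* Main.v *)
(** Finiteness of a colist is a Sigma-1 property: [marks l] is blue exactly as
    long as [l] goes on, so [l] is finite iff [marks l] has a red position.

    (2) -> (1): by Markov's Principle it suffices to refute that a colist over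
    the red positions of [s] is infinite. An infinite duplicate-free colist of
    naturals contains arbitrarily large ones, so it would make [s] infinitely
    often red.

    (1) -> (2): [blue_prefix s] is red exactly on the initial blue segment of
    [s]. If it is infinitely often red, then [s] is blue throughout. Enumerating
    its red positions in order gives a colist that stops at the first red
    position of [s], and streamlessness makes it stop. *)

From Stdlib Require Import List Lia.
Require Import Defs.

Set Implicit Arguments.

Lemma F_red_hd (s : stream) : hd s = R -> F red s.
Proof. destruct s as [c s]; simpl; intros ->; apply Here; exists s; reflexivity. Qed.

Lemma red_hd (s : stream) : red s -> hd s = R.
Proof. intros [s' ->]; reflexivity. Qed.

Lemma blue_hd (s : stream) : blue s -> hd s = B.
Proof. intros [s' ->]; reflexivity. Qed.

CoFixpoint marks (T : Type) (A : T -> Prop) (l : colist A) : stream :=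
  match l with
  | conil => const R
  | cocons _ _ l' => Cons B (marks l')
  end.

Lemma colist_finite_marks (T : Type) (A : T -> Prop) (l : colist A) :
  colist_finite l <-> F red (marks l).
Proof.
  split.
  - induction 1 as [A | A x Ax l _ IH].
    + apply F_red_hd; reflexivity.
    + apply Further; exact IH.
  - intros f; remember (marks l) as t eqn:E; revert A l E.
    induction f as [t r | t _ IH]; intros A [| x Ax l] ->; try constructor.
    + discriminate (red_hd r).
    + apply IH; reflexivity.
Qed.

(* Each element of the colist that lies in [L] uses up one entry of [L]. *)
Lemma infinite_colist_escapes (T : Type) (Q : T -> Prop) (n : nat) :
  forall (L : list T) (A : T -> Prop) (l : colist A),
    length L <= n -> G blue (marks l) ->
    (forall x, A x -> In x L \/ Q x) -> exists x, A x /\ Q x.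
Proof.
  induction n as [| n IH]; intros L A [| x Ax l] len inf cover;
    destruct inf as [b inf]; try discriminate (blue_hd b);
    destruct (cover x Ax) as [xL | Qx]; eauto.
  - destruct L; [destruct xL | simpl in len; lia].
  - destruct (in_split x L xL) as [L1 [L2 ->]].
    destruct (IH (L1 ++ L2) (remove A x) l) as [y [[Ay _] Qy]]; eauto.
    + rewrite length_app in *; simpl in len; lia.
    + intros y [Ay ne]; destruct (cover y Ay) as [yL | Qy]; auto.
      left; apply in_app_iff; apply in_app_iff in yL.
      destruct yL as [|[|]]; auto; congruence.
Qed.

Lemma infinite_colist_unbounded (A : nat -> Prop) (l : colist A) :
  G blue (marks l) -> forall n, exists x, A x /\ n <= x.
Proof.
  intros inf n.
  (* [seq 0 n] lists the numbers below [n], so whatever escapes it is at least [n]. *)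
  apply (infinite_colist_escapes (fun x => n <= x) (seq 0 n) l (le_n _) inf).
  intros x _; rewrite in_seq; lia.
Qed.

(** Unboundedness passes to tails, and any red position bounds the search for the first one. *)
Lemma nuU_unbounded_red (s : stream) :
  (forall n, exists x, red_positions s x /\ n <= x) -> nuU s.
Proof.
  apply (nuU_coind (X := fun s => forall n, exists x, red_positions s x /\ n <= x)).
  clear s; intros s unb.
  destruct (unb 0) as [x [redx _]]; revert s unb redx.
  induction x as [| x IH]; intros [c s] unb redx;
    (* A red position at least [S n] is not the head, so it shifts down into the tail. *)
    assert (unb' : forall n, exists x, red_positions s x /\ n <= x)
      by (intros n; destruct (unb (S n)) as [[| y] [redy le]];
          [lia | exists y; split; [exact redy | lia]]).
  - unfold red_positions, Str_nth in redx; simpl in redx; subst c.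
    constructor; exact unb'.
  - destruct c; constructor; auto.
Qed.

CoFixpoint blue_prefix (s : stream) : stream :=
  match s with
  | Cons R _ => const B
  | Cons B s' => Cons R (blue_prefix s')
  end.

Lemma blue_prefix_B (s : stream) :
  blue_prefix (Cons B s) = Cons R (blue_prefix s).
Proof. apply unfold_Stream. Qed.

Lemma blue_prefix_R (s : stream) : blue_prefix (Cons R s) = const B.
Proof. rewrite (unfold_Stream (blue_prefix _)), (unfold_Stream (const B)); reflexivity. Qed.

Lemma not_U_const_B (X : stream -> Prop) : ~ U X (const B).
Proof.
  intros u; remember (const B) as t eqn:E; revert E.
  induction u as [t _ IH | t _]; rewrite (unfold_Stream (const B)); simpl;
    intros E; inversion E; auto.
Qed.

(** At a red head the prefix becomes [const B], which fails [U]. *)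
Lemma nuU_blue_prefix (s : stream) : nuU (blue_prefix s) -> G blue s.
Proof.
  revert s; cofix CH; intros [[|] s] u.
  - exfalso; rewrite blue_prefix_R in u.
    exact (not_U_const_B (nuU_unfold u)).
  - constructor.
    + exists s; reflexivity.
    + apply CH; apply nuU_unfold in u; rewrite blue_prefix_B in u.
      inversion u; assumption.
Qed.

(** Keeps the enumeration duplicate-free: later positions are shifted past [n]. *)
Lemma remove_step (A : nat -> Prop) (n : nat) (s : stream) :
  (forall k, red_positions (blue_prefix (Cons B s)) k -> A (k + n)) ->
  forall k, red_positions (blue_prefix s) k -> remove A n (k + S n).
Proof.
  intros H k redk; split; [| lia].
  replace (k + S n) with (S k + n) by lia; apply H; exact redk.
Qed.

(* [n] is the offset of [s] in the stream whose positions are enumerated. *)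
CoFixpoint enum_prefix (s : stream) :
  forall (A : nat -> Prop) (n : nat),
    (forall k, red_positions (blue_prefix s) k -> A (k + n)) -> colist A :=
  match s with
  | Cons R _ => fun A n H => conil
  | Cons B s' => fun A n H =>
      cocons n (H 0 eq_refl) (enum_prefix s' _ (S n) (remove_step A n s' H))
  end.

(** The marks and [s] first turn red at the same position, where the colist ends. *)
Lemma F_red_enum_prefix (s : stream) (A : nat -> Prop) (n : nat)
    (H : forall k, red_positions (blue_prefix s) k -> A (k + n)) :
  F red (marks (enum_prefix s A n H)) -> F red s.
Proof.
  intros f; remember (marks (enum_prefix s A n H)) as t eqn:E; revert s A n H E.
  induction f as [t r | t _ IH]; intros [[|] s] A n H ->;
    try (apply F_red_hd; reflexivity).
  - discriminate (red_hd r).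
  - apply Further; eapply IH; reflexivity.
Qed.

Theorem corollary4p2 :
  (forall s : stream, ~ nuU s -> streamless (red_positions s))
  <->
  (forall s : stream, ~ G blue s -> F red s).
Proof.
  split.
  - intros streamless_red s nb.
    assert (H : forall k, red_positions (blue_prefix s) k ->
                          red_positions (blue_prefix s) (k + 0))
      by (intros k; rewrite PeanoNat.Nat.add_0_r; trivial).
    apply (F_red_enum_prefix s (red_positions (blue_prefix s)) 0 H), colist_finite_marks, streamless_red.
    intros u; apply nb, nuU_blue_prefix, u.
  - intros markov s nu l; apply colist_finite_marks, markov; intros inf.
    apply nu, nuU_unbounded_red, (infinite_colist_unbounded l inf).
Qed.
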